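(* Let $C$ be a nonempty convex subset of $X$, let $F\colon X\to Y\cup\{+\infty_Y\}$ be a proper $K$-convex mapping, and let $G\colon X\to Z\cup\{+\infty_Z\}$ be a proper $S$-convex mapping. Let $A:=C\cap G^{-1}(-S)$ and $E:=G(C\cap\operatorname{dom}F\cap\operatorname{dom}G)+S$. Assume that $A\cap\operatorname{dom}F\neq\emptyset$ and that at least one of the following conditions holds: $(c_1)$ there exists $\bar x\in C\cap\operatorname{dom}F$ such that $G(\bar x)\in-\operatorname{int}S$; $(c_2)$ $X,Z$ are Fréchet spaces, $C$ is closed, $y^*\circ F$ is lower semicontinuous for all $y^*\in Y^*$, $G$ is $S$-epi closed and $0_Z\in\operatorname{sqri}E$; $(c_3)$ $\dim\operatorname{lin}E<+\infty$ and $0_Z\in\operatorname{ri}E$. Then $$\operatorname{epi}_K(F+I_A)^*=\bigcup_{T\in\mathcal{L}_+(S,K)}\operatorname{epi}_K(F+I_C+T\circ G)^*.$$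
   Context: $X,Y,Z$ are (real) locally convex Hausdorff topological vector spaces with topological duals $X^*,Y^*,Z^*$; $K\subset Y$ is a closed, pointed, convex cone with $\operatorname{int}K\neq\emptyset$; $S\subset Z$ is a nonempty closed convex cone. Order and infinite elements: for $y_1,y_2\in Y$, $y_1<_K y_2$ means $y_1-y_2\in-\operatorname{int}K$. $Y^\bullet:=Y\cup\{-\infty_Y,+\infty_Y\}$, where $\pm\infty_Y\notin Y$ and $-\infty_Y<_K y<_K+\infty_Y$ for all $y\in Y$ (hence also $-\infty_Y<_K+\infty_Y$). Conventions: $-(+\infty_Y)=-\infty_Y$, $-(-\infty_Y)=+\infty_Y$, $(+\infty_Y)+y=y+(+\infty_Y)=+\infty_Y$ for $y\in Y\cup\{+\infty_Y\}$, $(-\infty_Y)+y=y+(-\infty_Y)=-\infty_Y$ for $y\in Y\cup\{-\infty_Y\}$. Analogous elements $\pm\infty_Z$ and conventions are used for $Z$ (ordered by $S$). Weak supremum: for $\emptyset\neq M\subset Y^\bullet$, $\operatorname{WSup}M$ is the set of $\bar v\in Y^\bullet$ such that $\bar v\not<_K v$ for all $v\in M$, and for every $\tilde v\in Y^\bullet$ with $\tilde v<_K\bar v$ there is $v\in M$ with $\tilde v<_K v$. Mappings: for $F\colon X\to Y^\bullet$, $\operatorname{dom}F=\{x\in X: F(x)\neq+\infty_Y\}$; $F$ is proper if $\operatorname{dom}F\neq\emptyset$ and $-\infty_Y\notin F(X)$; $\operatorname{epi}_KF=\{(x,y)\in X\times Y: y\in F(x)+K\}$; $F$ is $K$-convex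 if $\operatorname{epi}_KF$ is convex, and $K$-epi closed if it is closed. The same notions are used for $G$ with $(Z,S)$ in place of $(Y,K)$. For $y^*\in Y^*$, $(y^*\circ F)(x)=y^*(F(x))$ if $F(x)\in Y$ and $+\infty$ if $F(x)=+\infty_Y$. $\mathcal{L}(X,Y)$ is the space of continuous linear mappings $X\to Y$. The conjugate of $F$ is the set-valued map $F^*(L)=\operatorname{WSup}\{L(x)-F(x):x\in X\}$, $L\in\mathcal{L}(X,Y)$, and $\operatorname{epi}_KF^*=\{(L,y)\in\mathcal{L}(X,Y)\times Y: y\in F^*(L)+K\}$. For $D\subset X$, $I_D(x)=0_Y$ if $x\in D$ and $I_D(x)=+\infty_Y$ otherwise. For $T\in\mathcal{L}(Z,Y)$, $(T\circ G)(x)=T(G(x))$ if $G(x)\in Z$ and $+\infty_Y$ if $G(x)=+\infty_Z$. $\mathcal{L}_+(S,K)=\{T\in\mathcal{L}(Z,Y): T(S)\subset K\}$. For a convex set $U$: $\operatorname{lin}U$ is its linear hull, $\operatorname{ri}U$ its relative interior (interior relative to its affine hull), and $\operatorname{sqri}U$ its strong quasi-relative interior, i.e. the set of $u\in U$ such that the cone $\bigcup_{\lambda\ge 0}\lambda(U-u)$ is a closed linear subspace. *)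

(* Defs.v *)
From HB Require Import structures.
From mathcomp Require Import all_boot all_order all_algebra.
From mathcomp Require Import all_classical all_reals all_analysis.

Set Implicit Arguments.
Unset Strict Implicit.
Unset Printing Implicit Defensive.

Import Order.TTheory GRing.Theory Num.Theory.
Import numFieldNormedType.Exports.

Local Open Scope classical_set_scope.
Local Open Scope ring_scope.

(* tvsType R is the library's type of locally convex topological vector       *)
(* spaces; it does not include Hausdorffness. Its uniform structure is only   *)
(* required to induce the topology, so nothing below refers to it.            *)

Record clinear (R : realType) (V W : tvsType R) := CLinear {
  clinear_fun :> {linear V -> W} ;
  clinear_continuous : continuous clinear_fun }.

Section sets_in_a_vector_space.
Context {R : realType} {V : tvsType R}.
Implicit Types U : set V.

Definition cone U := forall (l : R) v, 0 <= l -> U v -> U (l *: v).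

Definition pointed_cone U := U `&` (-%R @` U) = [set 0].

Definition linear_subspace U :=
  U 0 /\ forall (l : R) u v, U u -> U v -> U (l *: u + v).

Definition affine_set U :=
  forall (l : R) u v, U u -> U v -> U (l *: u + (1 - l) *: v).

Definition lin U := smallest linear_subspace U.

Definition aff U := smallest affine_set U.

Definition finite_dim U := exists s : seq V, U `<=` lin [set` s].

(* interior of U in the subspace topology of aff U *)
Definition ri U := [set u | aff U u /\ within (aff U) (nbhs u) U].

Definition sqri U := [set u | U u /\
  let W := [set l *: (v - u) | l in [set l : R | 0 <= l] & v in U] in
  linear_subspace W /\ closed W].

End sets_in_a_vector_space.

(* The topology comes from a complete translation-invariant metric.           *)
Definition frechet (R : realType) (V : tvsType R) :=
  exists d : V -> V -> R,
    [/\ forall x y, d x y = 0 <-> x = y,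
        forall x y, d x y = d y x &
        forall x y z, d x z <= d x y + d y z] /\
    [/\ forall x y z, d (x + z) (y + z) = d x y,
        forall x (A : set V),
          nbhs x A <-> exists2 e : R, 0 < e & [set y | d x y < e] `<=` A &
        forall u : nat -> V,
          (forall e : R, 0 < e -> exists N, forall m n,
             (N <= m)%N -> (N <= n)%N -> d (u m) (u n) < e) ->
          exists l : V, u @ \oo --> l].

(* V with -oo and +oo added is \bar V. The library's addition is total, with  *)
(* +oo + -oo = -oo; this case does not arise for mappings that avoid -oo.     *)
Section extended_space.
Context {R : realType} {V : tvsType R}.
Implicit Types (K : set V) (M : set (\bar V)).

Definition wlt K (u v : \bar V) : Prop :=
  match u, v with
  | y1%:E, y2%:E => (-%R @` interior K) (y1 - y2)
  | -oo%E, _%:E | -oo%E, +oo%E | _%:E, +oo%E => True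
  | _, _ => False
  end.

Definition WSup K M : set (\bar V) :=
  [set v | (forall w, M w -> ~ wlt K v w) /\
           (forall t, wlt K t v -> exists2 w, M w & wlt K t w)].

Definition addset M K : set (\bar V) := [set (m + k%:E)%E | m in M & k in K].

End extended_space.

Section mappings.
Context {R : realType} {X Y : tvsType R}.
Implicit Types (K : set Y) (F : X -> \bar Y) (D : set X).

Definition dom F : set X := [set x | F x <> +oo%E].

Definition proper_map F := dom F !=set0 /\ ~ range F -oo%E.

Definition epi K F : set (X * Y) := [set p | addset [set F p.1] K p.2%:E].

Definition cone_convex K F := @convex_set R (X * Y)%type (epi K F).

Definition epi_closed K F := closed (epi K F).

Definition conjugate K F (L : clinear X Y) : set (\bar Y) :=
  WSup K [set ((L x)%:E - F x)%E | x in [set: X]].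

Definition epi_conjugate K F : set (clinear X Y * Y) :=
  [set p | addset (conjugate K F p.1) K p.2%:E].

Definition indicator D (x : X) : \bar Y := if x \in D then 0%E else +oo%E.

Definition Lplus (S : set X) K : set (clinear X Y) :=
  [set T | T @` S `<=` K].

(* er_map sends +oo to +oo; its value at -oo is irrelevant for proper F.      *)
Definition lcomp (W : tvsType R) (T : clinear Y W) F : X -> \bar W :=
  er_map T \o F.

End mappings.

(* Main.v *)
Require Import Defs.
From HB Require Import structures.
From mathcomp Require Import all_boot all_order all_algebra.
From mathcomp Require Import all_classical all_reals all_analysis.
From mathcomp Require Import lra.

Set Implicit Arguments.
Unset Strict Implicit.
Unset Printing Implicit Defensive.

Import Order.TTheory GRing.Theory Num.Theory.
Import numFieldNormedType.Exports.

Local Open Scope classical_set_scope.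
Local Open Scope ring_scope.

(** Among mappings that avoid -oo and are finite somewhere, [(L, y)] lies in the
    epigraph of the conjugate of [F] iff no [L x - F x] is strictly above [y],
    that is, iff [L x - F x - y] is never interior to [K] ([epi_conjugateP]).

    The inclusion from right to left is weak duality: if [x] is feasible and [T]
    maps [S] into [K], then [- T (G x)] belongs to [K], so that
    [L x - F x - T (G x)] is strictly above [y] as soon as [L x - F x] is.

    For the converse, let [(L, y)] belong to the left-hand side. Then the convex
    set of all [(F x + y - L x + k, G x + s)], with [x] in [C], [k] in [K] and [s]
    in [S], contains no [(v, 0)] with [- v] interior to [K]. Each qualification
    makes [E], which is the projection of this set to [Z], absorbing in the linear
    subspace that it spans, and then the algebraic Hahn-Banach theorem gives
    linear functionals [ys], nonnegative on [K] and equal to 1 at a chosen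
    interior point [k0] of [K], and [zs], with
    [ys (F x + y - L x) + zs (G x) >= 0] on [C] ([convex_minorant],
    [vector_lagrange_multipliers]). If [zs] agrees on [E] with a continuous
    functional [k], then [T z := k z *: k0] is the required operator: an interior
    point [L x - F x - T (G x) - y] of [K] would have a positive image under [ys].

    The existence of [k] is what distinguishes the three qualifications. Under
    Slater's condition [zs] is bounded below on a neighbourhood of 0. If [E] is
    finite-dimensional, [zs] is composed with a continuous projection onto a
    space containing [E] ([finite_dim_projection]). In the Frechet case a bound
    for [zs] from below, on a neighbourhood of 0 in the closed subspace spanned by
    [E], follows from the open mapping theorem for closed convex relations
    ([closed_convex_relation_open], proved from Baire's theorem), and the
    restriction of [zs] to that subspace is then extended continuously
    ([continuous_linear_extension]). *)

(** * Convex sets, linear maps and affine inequalities *)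

Lemma convex_setP (R : realType) (V : lmodType R) (A : set V) :
  convex_set A <-> forall t u v, 0 <= t -> t <= 1 -> A u -> A v ->
    A (t *: u + (1 - t) *: v).
Proof.
split=> [Ac t u v t0 t1 Au Av|Ac u v l /set_mem Au /set_mem Av].
  have t01 : Itv.spec (@Itv.num_sem R) (Itv.Real `[0%Z, 1%Z]) t.
    by rewrite /= /Itv.num_sem in_itv/= t0 t1 ger0_real.
  by have /set_mem := Ac u v (Itv.mk t01) (mem_set Au) (mem_set Av).
by apply: mem_set; apply: Ac.
Qed.

Lemma convex_conic_comb (R : realType) (V : lmodType R) (A : set V) (t s : R) u w :
  convex_set A -> 0 <= t -> 0 <= s -> 0 < t + s -> A u -> A w ->
  exists2 v, A v & t *: u + s *: w = (t + s) *: v.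
Proof.
move=> /convex_setP Ac t0 s0 ts Au Aw.
have tsN0 : t + s != 0 by rewrite gt_eqF.
have sE : 1 - t / (t + s) = s / (t + s).
  by apply: (mulIf tsN0); rewrite mulrBl !mulfVK// mul1r; lra.
exists (t / (t + s) *: u + (1 - t / (t + s)) *: w).
  apply: Ac => //; first by rewrite divr_ge0// ltW.
  by rewrite ler_pdivrMr// mul1r lerDl.
by rewrite sE scalerDr !scalerA ![(t + s) * _]mulrC !mulfVK.
Qed.

Lemma ray_slope_ge0 (R : realType) (a b : R) :
  (forall t, 0 <= t -> 0 <= a + t * b) -> 0 <= b.
Proof.
move=> H; have := H 0 (lexx 0); rewrite mul0r addr0 => a0.
rewrite leNgt; apply/negP => b_neg.
have t0 : 0 <= (a + 1) / - b by rewrite divr_ge0//; lra.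
by have := H _ t0; rewrite invrN mulrN mulNr mulfVK ?lt_eqF//; lra.
Qed.

Lemma linear_of_fun (R : realType) (V W : lmodType R) (f : V -> W) :
  (forall l u v, f (l *: u + v) = l *: f u + f v) ->
  exists h : {linear V -> W}, forall v, h v = f v.
Proof.
move=> flin.
pose m := GRing.isLinear.Build R V W *:%R f flin.
by exists (HB.pack_for {linear V -> W} f m).
Qed.

(** * Linear minorants *)

Section linear_minorant.
Context {R : realType} {V : lmodType R}.
Implicit Types (P : R -> V -> Prop) (H : set (V * R)).

Let pre_minorant P H :=
  (forall l p q, H p -> H q -> H (l *: p.1 + q.1, l * p.2 + q.2)) /\
  (forall v a r, H (v, a) -> P r v -> a <= r).

(** Hahn-Banach, for the sublinear functional that maps [v] to the infimum of
    the [r] with [P r v], on the subspace of those [v] for which such an [r]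
    exists. Working with the convex cone [P] avoids the infimum and any extension
    of the sublinear functional to [V]: a maximal partial minorant [H], encoded
    by its graph, is total, since the constraints on its value at a new point [z]
    come either from both sides or from neither. *)
Lemma sublinear_cone_minorant P :
  P 0 0 ->
  (forall t r v, 0 < t -> P r v -> P (t * r) (t *: v)) ->
  (forall r1 v1 r2 v2, P r1 v1 -> P r2 v2 -> P (r1 + r2) (v1 + v2)) ->
  (forall r, P r 0 -> 0 <= r) ->
  (forall r v, P r v -> exists r', P r' (- v)) ->
  exists h : {linear V -> R^o}, forall r v, P r v -> h v <= r.
Proof.
move=> P0 Pscale Padd Ppos Psym.
have [H [[Hlin HP] Hmax]] : exists H, pre_minorant P H /\
    forall B, H `<` B -> ~ pre_minorant P B.
  apply: Zorn_bigcup => F FP Ftot; split.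
  - move=> l p q [A FA Ap] [B FB Bq]; case: (Ftot _ _ FA FB) => sub.
      by exists B => //; apply: (FP _ FB).1 => //; exact: sub.
    by exists A => //; apply: (FP _ FA).1 => //; exact: sub.
  - by move=> v a r [A FA Aa]; exact: (FP _ FA).2.
have H0 : H (0, 0).
  apply: contrapT => H0.
  have noH p : ~ H p.
    move=> Hp; apply: H0; have := Hlin (-1) p p Hp Hp.
    by rewrite scaleN1r mulN1r !addNr.
  apply: (Hmax [set (0, 0)]).
    split; first by move=> p /noH.
    by move=> sub; apply: (noH (0, 0)); exact: sub.
  split; first by move=> l p q -> -> /=; rewrite scaler0 mulr0 !addr0.
  by move=> v a r [-> ->]; exact: Ppos.
have HZ l v a : H (v, a) -> H (l *: v, l * a).
  by move=> Hv; have := Hlin l (v, a) (0, 0) Hv H0; rewrite /= !addr0.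
have HD v a w b : H (v, a) -> H (w, b) -> H (v + w, a + b).
  by move=> Hv Hw; have := Hlin 1 _ _ Hv Hw; rewrite /= scale1r mul1r.
have HN v a : H (v, a) -> H (- v, - a).
  by move=> /(HZ (-1)); rewrite scaleN1r mulN1r.
have Hfun v a b : H (v, a) -> H (v, b) -> a = b.
  have le0 c : H (0, c) -> c <= 0 by move=> Hc; exact: HP Hc P0.
  move=> Ha Hb.
  have h1 := HD _ _ _ _ Ha (HN _ _ Hb); have h2 := HN _ _ h1.
  move: h1 h2; rewrite subrr oppr0 => /le0 h1 /le0 h2.
  by apply/eqP; rewrite eq_le; lra.
have Htot z : exists a, H (z, a).
  apply: contrapT => nz.
  (* [up] and [lo] collect the upper and lower bounds on the value at [z] of
     an extension of [H]. *)
  pose up := [set c | exists v a r, [/\ H (v, a), P r (v + z) & c = r - a]].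
  pose lo := [set c | exists v a r, [/\ H (v, a), P r (v - z) & c = a - r]].
  have lo_up c d : lo c -> up d -> c <= d.
    move=> [v [a [r [Hv Pv ->]]]] [w [b [s [Hw Pw ->]]]].
    have : a + b <= r + s.
      apply: (HP (v + w)); first exact: HD.
      have -> : v + w = (v - z) + (w + z) by rewrite addrACA addNr addr0.
      exact: Padd.
    by lra.
  have upN c : up c -> lo !=set0.
    move=> [v [a [r [Hv Pv _]]]]; have [r' Pr'] := Psym _ _ Pv.
    by exists (- a - r'), (- v), (- a), r'; rewrite -opprD; split=> //; exact: HN.
  have loN c : lo c -> up !=set0.
    move=> [v [a [r [Hv Pv _]]]]; have [r' Pr'] := Psym _ _ Pv.
    exists (r' - - a), (- v), (- a), r'; split=> //; first exact: HN.
    by rewrite addrC -opprB.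
  have [a0 [ha0 h0a]] : exists a0, (forall c, up c -> a0 <= c) /\
      (forall c, lo c -> c <= a0).
    have [[c loc]|nolo] := pselect (lo !=set0); last first.
      by exists 0; split=> [c /upN|c loc] //; case: nolo; exists c.
    have [d upd] := loN _ loc.
    exists (sup lo); split=> [e upe|e loe].
      by apply: ge_sup; [exists c|move=> f lof; exact: lo_up].
    apply: ub_le_sup => //; exists d => f lof; exact: lo_up.
  pose B := [set p | exists v a t, H (v, a) /\ p = (v + t *: z, a + t * a0)].
  apply: (Hmax B).
    split.
      by move=> [v a] Hv; exists v, a, 0; rewrite scale0r mul0r !addr0.
    move=> BH; apply: nz; exists a0; apply: BH; exists 0, 0, 1.
    by rewrite scale1r mul1r !add0r.
  split.
    move=> l _ _ [v [a [t [Hv ->]]]] [w [b [s [Hw ->]]]] /=.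
    exists (l *: v + w), (l * a + b), (l * t + s); split; first exact: Hlin Hv Hw.
    congr (_, _); last by lra.
    by rewrite scalerDr scalerA addrACA -scalerDl.
  move=> _ _ r [v [a [t [Hv [-> ->]]]]] Pr.
  have [t0|t0|t0] := ltgtP t 0.
  - have i0 : 0 < (- t)^-1 by rewrite invr_gt0 oppr_gt0.
    have it : (- t)^-1 * t = - 1 by rewrite invrN mulNr mulVf// lt_eqF.
    have := Pscale _ _ _ i0 Pr; rewrite scalerDr scalerA it scaleN1r => Ps.
    have : (- t)^-1 * a - (- t)^-1 * r <= a0.
      apply: h0a; exists ((- t)^-1 *: v), ((- t)^-1 * a), ((- t)^-1 * r).
      by split=> //; exact: HZ.
    by rewrite -mulrBr ler_pdivrMl ?oppr_gt0// => ?; lra.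
  - have i0 : 0 < t^-1 by rewrite invr_gt0.
    have := Pscale _ _ _ i0 Pr.
    rewrite scalerDr scalerA mulVf ?gt_eqF// scale1r => Ps.
    have : a0 <= t^-1 * r - t^-1 * a.
      by apply: ha0; exists (t^-1 *: v), (t^-1 * a), (t^-1 * r); split=> //; exact: HZ.
    by rewrite -mulrBr ler_pdivlMl// => ?; lra.
  - by move: Pr; rewrite t0 scale0r mul0r !addr0; exact: HP.
have [f Hf] := choice Htot.
have [h hf] : exists h : {linear V -> R^o}, forall v, h v = f v.
  apply: linear_of_fun => l u v; apply: Hfun (Hf _) _.
  exact: (Hlin l (u, f u) (v, f v)).
by exists h => r v Pv; rewrite hf; exact: HP (Hf v) Pv.
Qed.

(** The cone spanned by a convex set inherits from it the hypotheses of
    [sublinear_cone_minorant]. The last hypothesis says that the projection of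
    [P] to [V] is absorbing in the subspace that it spans; it is the algebraic
    core of every constraint qualification below. *)
Lemma convex_minorant P :
  convex_set [set p : R^o * V | P p.1 p.2] ->
  (forall r, P r 0 -> 0 <= r) ->
  (forall r v, P r v -> exists2 t, 0 < t & exists r', P r' (- (t *: v))) ->
  exists h : {linear V -> R^o}, forall r v, P r v -> h v <= r.
Proof.
move=> Pconv Ppos Psym.
pose Q r v := (r = 0 /\ v = 0) \/
  exists t r' v', [/\ 0 < t, P r' v', r = t * r' & v = t *: v'].
have [||||| h hQ] := @sublinear_cone_minorant Q.
- by left.
- move=> t r v t0 [[-> ->]|[s [r' [v' [s0 Pv -> ->]]]]].
    by left; rewrite mulr0 scaler0.
  right; exists (t * s), r', v'; split=> //; first exact: mulr_gt0.
    by rewrite mulrA.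
  by rewrite scalerA.
- move=> r1 v1 r2 v2 [[-> ->]|Q1]; first by rewrite !add0r.
  move=> [[-> ->]|Q2]; first by rewrite !addr0; right.
  move: Q1 Q2 => [t [r [v [t0 Pv -> ->]]]] [s [q [w [s0 Pw -> ->]]]].
  have ts : 0 < t + s by exact: addr_gt0.
  have [[r' v'] Prv [rE vE]] :=
    convex_conic_comb (u := (r, v)) (w := (q, w)) Pconv (ltW t0) (ltW s0) ts Pv Pw.
  by right; exists (t + s), r', v'.
- move=> r [[-> _]|[t [r' [v' [t0 Pv -> /esym/eqP]]]]]; first exact: lexx.
  rewrite scaler_eq0 gt_eqF//= => /eqP v0; rewrite pmulr_rge0//.
  by apply: Ppos; rewrite -v0.
- move=> r v [[_ ->]|[t [r' [v' [t0 Pv _ ->]]]]].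
    by exists 0; left; rewrite oppr0.
  have [s s0 [q Pq]] := Psym _ _ Pv.
  exists (t / s * q); right; exists (t / s), q, (- (s *: v')); split=> //.
    exact: divr_gt0.
  by rewrite scalerN scalerA mulfVK// gt_eqF.
exists h => r v Pv; apply: hQ; right; exists 1, r, v.
by rewrite mul1r scale1r.
Qed.

End linear_minorant.

(** * Continuous linear functionals on locally convex spaces *)

Section topological_vector_space.
Context {R : realType} {V : tvsType R}.

Lemma affine_continuous (a : R) (b : V) : continuous (fun v : V => a *: v + b).
Proof.
move=> v; apply: (cvg_comp2 _ (cvg_cst b) (add_continuous (_, _))).
exact: (cvg_comp2 (cvg_cst (a : R^o)) cvg_id (scale_continuous (_, _))).
Qed.

Lemma nbhs_affine (a : R) (b v : V) (U : set V) :
  nbhs (a *: v + b) U -> nbhs v [set u | U (a *: u + b)].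
Proof. exact: affine_continuous. Qed.

Lemma nbhs0_absorbs (U : set V) (v : V) : nbhs 0 U ->
  exists2 e : R, 0 < e & forall t, `|t| < e -> U (t *: v).
Proof.
move=> U0; have : nbhs (0 : R^o) [set t : R^o | U (t *: v)].
  apply: (cvg_comp2 cvg_id (cvg_cst v) (scale_continuous (_, _))).
  by rewrite scale0r.
by move=> /nbhs_ballP[e /= e0 eU]; exists e => // t te; apply: eU;
  rewrite /ball /= sub0r normrN.
Qed.

Lemma nbhs0_absconvex (U : set V) : nbhs 0 U ->
  exists2 W, nbhs 0 W & [/\ W `<=` U, convex_set W & forall v, W v -> W (- v)].
Proof.
move=> U0; have [B Bconvex [Bopen Bbasis]] := @locally_convex R V.
have [W [BW W0] WU] := Bbasis _ _ U0.
have nW : nbhs 0 W by apply: open_nbhs_nbhs; split=> //; exact: Bopen.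
have /convex_setP Wconv := Bconvex _ (mem_set BW).
exists (W `&` [set v | W (- v)]).
  apply: filterI => //; have := @nbhs_affine (-1) 0 0 W.
  rewrite scaler0 addr0 => /(_ nW).
  by apply: filterS => v /=; rewrite scaleN1r addr0.
split; first by move=> v [/WU].
- apply/convex_setP => t u v t0 t1 [Wu Wu'] [Wv Wv']; split; first exact: Wconv.
  by rewrite /= opprD -!scalerN; exact: Wconv.
- by move=> v [Wv Wv']; split; rewrite //= opprK.
Qed.

(** On a symmetric neighbourhood of 0, a lower bound is a bound on the modulus. *)
Lemma linear_lower_bounded_continuous (h : {linear V -> R^o}) (U : set V) (c : R) :
  nbhs 0 U -> (forall v, U v -> - c <= h v) -> continuous h.
Proof.
move=> U0 hU v; have [W W0 [WU _ Wsym]] := nbhs0_absconvex U0.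
have hW u : W u -> `|h u| <= `|c|.
  move=> Wu; have := hU _ (WU _ Wu); have := hU _ (WU _ (Wsym _ Wu)).
  rewrite linearN ler_norml; have := ler_norm c.
  by move=> ? ? ?; apply/andP; split; lra.
apply/cvgrPdist_lt => e e0.
pose a := (`|c| + 1) / e; have a0 : 0 < a.
  by rewrite divr_gt0// ltr_wpDl.
have : nbhs v [set u | W (a *: u + - (a *: v))].
  by apply: nbhs_affine; rewrite subrr.
apply: filterS => u /= /hW; rewrite -scalerBr linearZ/=.
rewrite normrM (gtr0_norm a0) linearB/= distrC => hu.
rewrite -(ltr_pM2l a0) (le_lt_trans hu)// /a mulrVK ?unitfE ?gt_eqF//.
by rewrite ltrDl.
Qed.

(** The extension is obtained from the sublinear functional whose epigraph is
    spanned by the graph of [h] on [M] and by the points of height [c] above a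
    convex symmetric neighbourhood [W] of 0: a minorant of it agrees with [h]
    on [M], and is bounded on [W]. *)
Lemma continuous_linear_extension (M : set V) (h : {linear V -> R^o})
    (U : set V) (c : R) :
  linear_subspace M -> nbhs 0 U -> (forall v, U v -> M v -> - c <= h v) ->
  exists k : clinear V R^o, forall v, M v -> k v = h v.
Proof.
move=> [M0 Mlin] U0 hU; have [W W0 [WU Wconv Wsym]] := nbhs0_absconvex U0.
have MZ t v : M v -> M (t *: v).
  by move=> Mv; rewrite -[_ *: v]addr0; exact: Mlin.
have MN v : M v -> M (- v) by rewrite -scaleN1r; exact: MZ.
pose P r v := exists m u t, [/\ M m, W u, 0 <= t, v = m + t *: u & r = h m + t * `|c|].
have W00 : W 0 by exact: nbhs_singleton.
have [||||| k kP] := @sublinear_cone_minorant R V P.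
- by exists 0, 0, 0; rewrite !linear0 mul0r !addr0; split.
- move=> s _ _ s0 [m [u [t [Mm Wu t0 -> ->]]]].
  exists (s *: m), u, (s * t); split=> //; first exact: MZ.
  + by rewrite mulr_ge0// ltW.
  + by rewrite scalerDr scalerA.
  + by rewrite linearZ/= mulrDr mulrA.
- move=> _ _ _ _ [m [u [t [Mm Wu t0 -> ->]]]] [n [w [s [Mn Ww s0 -> ->]]]].
  have Mmn : M (m + n) by rewrite -[m]scale1r; exact: Mlin.
  have [ts0|ts0] := eqVneq (t + s) 0.
    have [-> ->] : t = 0 /\ s = 0 by split; lra.
    by exists (m + n), 0, 0; rewrite !scale0r !mul0r !addr0 linearD.
  have tsp : 0 < t + s by rewrite lt_neqAle eq_sym ts0 addr_ge0.
  have [v Wv vE] := convex_conic_comb Wconv t0 s0 tsp Wu Ww.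
  exists (m + n), v, (t + s); split=> //; first exact: ltW.
    by rewrite addrACA vE.
  by rewrite linearD/= mulrDl addrACA.
- move=> r [m [u [t [Mm Wu t0 /esym/eqP mtu ->]]]].
  have [tz|tz] := eqVneq t 0.
    by move: mtu; rewrite tz scale0r addr0 => /eqP ->; rewrite linear0 mul0r addr0.
  have tp : 0 < t by rewrite lt_neqAle eq_sym tz.
  move: mtu; rewrite addr_eq0 => /eqP mE.
  have Mu : M (- u).
    have -> : - u = t^-1 *: m by rewrite mE scalerN scalerA mulVf// scale1r.
    exact: MZ.
  have := hU _ (WU _ (Wsym _ Wu)) Mu.
  rewrite mE !linearN linearZ/= -mulrN -mulrDr => hu.
  by apply: mulr_ge0 => //; have := ler_norm c; lra.
- move=> _ _ [m [u [t [Mm Wu t0 -> _]]]].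
  exists (h (- m) + t * `|c|), (- m), (- u), t; split=> //; first exact: MN.
    exact: Wsym.
  by rewrite scalerN opprD.
have kW v : W v -> - `|c| <= k v.
  move=> Wv; have : k (- v) <= `|c|.
    apply: kP; exists 0, (- v), 1; split=> //; first exact: Wsym.
      by rewrite scale1r add0r.
    by rewrite linear0 mul1r add0r.
  by rewrite linearN/=; lra.
exists (CLinear (linear_lower_bounded_continuous W0 kW)) => v Mv /=.
have le_kh u : M u -> k u <= h u.
  move=> Mu; apply: kP; exists u, 0, 0; split=> //.
    by rewrite scaler0 addr0.
  by rewrite mul0r addr0.
apply/eqP; rewrite eq_le le_kh//=.
by have := le_kh _ (MN _ Mv); rewrite !linearN/=; lra.
Qed.

(** The coordinate on the line spanned by [v] is bounded near 0 on that line: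
    a multiple [t *: v] with [1 <= `|t|] lies outside every convex symmetric
    neighbourhood of 0 that avoids [v]. *)
Lemma continuous_linear_separates (v : V) : hausdorff_space V -> v != 0 ->
  exists k : clinear V R^o, k v = 1.
Proof.
move=> hV v0.
have [||||| h hP] := @sublinear_cone_minorant R V (fun r u => u = r *: v).
- by rewrite scale0r.
- by move=> t r _ _ ->; rewrite scalerA.
- by move=> r _ s _ -> ->; rewrite scalerDl.
- by move=> r /esym/eqP; rewrite scaler_eq0 (negbTE v0) orbF => /eqP->.
- by move=> r _ ->; exists (- r); rewrite scaleNr.
have hv : h v = 1.
  apply/eqP; rewrite eq_le hP ?scale1r//=.
  by have := hP (-1) (- v); rewrite scaleN1r linearN/= => /(_ erefl); lra.
have [U U0 Uv] : exists2 U, nbhs 0 U & ~ U v.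
  apply: contrapT => nU; move/eqP: v0; apply; apply/esym/hV => A B nA nB.
  have [Av|nAv] := pselect (A v); last by case: nU; exists A.
  by exists v; split=> //; exact: nbhs_singleton.
have [W W0 [WU /convex_setP Wconv Wsym]] := nbhs0_absconvex U0.
pose M := [set t *: v | t in [set: R]].
have Mlin : linear_subspace M.
  split; first by exists 0 => //; rewrite scale0r.
  move=> l _ _ [t _ <-] [s _ <-]; exists (l * t + s) => //.
  by rewrite scalerDl scalerA.
have [|k kh] := @continuous_linear_extension M h W 1 Mlin W0.
  move=> u Wu [t _ tE]; rewrite -tE in Wu *.
  rewrite linearZ/= hv /GRing.scale/= mulr1 leNgt; apply/negP => t1.
  apply/Uv/WU; have -> : v = - t^-1 *: (- (t *: v)) + (1 - - t^-1) *: 0.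
    by rewrite scaler0 addr0 scalerN scaleNr opprK scalerA mulVf ?scale1r// lt_eqF//; lra.
  have tn : 0 < - t by lra.
  apply: Wconv; [| |exact: Wsym|exact: nbhs_singleton].
    by rewrite -invrN invr_ge0 ltW.
  by rewrite -invrN invf_le1//; lra.
by exists k; rewrite kh//; exists 1 => //; rewrite scale1r.
Qed.

(** In a Hausdorff space every finite-dimensional subspace is the range of a
    continuous projection of finite rank, built here by adjoining one spanning
    vector at a time. Its rank being finite, it turns every linear functional
    into a continuous one; this replaces the uniqueness of the vector topology
    in finite dimension. *)
Lemma finite_dim_projection (s : seq V) : hausdorff_space V ->
  exists p : {linear V -> V}, (forall v, v \in s -> p v = v) /\
    forall h : {linear V -> R^o}, continuous (h \o p).
Proof.
move=> hV; elim: s => [|a s [p [ps pc]]].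
  have [p p0] : exists p : {linear V -> V}, forall v, p v = 0.
    by apply: linear_of_fun => l u v; rewrite scaler0 addr0.
  exists p; split=> // h.
  rewrite (_ : h \o p = cst 0); first exact: cst_continuous.
  by apply/funext => v /=; rewrite p0 linear0.
have [pa|pa] := eqVneq (a - p a) 0.
  exists p; split=> // v; rewrite inE => /orP[/eqP->|/ps//].
  by apply/esym/eqP; rewrite -subr_eq0 pa.
have [e ea] := continuous_linear_separates hV pa.
have [q qE] : exists q : {linear V -> V},
    forall v, q v = p v + e (v - p v) *: (a - p a).
  apply: linear_of_fun => l u v; rewrite [l *: (p u + _)]scalerDr scalerA addrACA -scalerDl.
  have -> : e (l *: u + v - p (l *: u + v)) = l * e (u - p u) + e (v - p v).
    by rewrite !linearB/= !linearP/= /GRing.scale/=; lra.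
  by rewrite linearP.
exists q; split=> [v|h].
  rewrite inE qE => /orP[/eqP->|/ps->]; first by rewrite ea scale1r addrC subrK.
  by rewrite subrr linear0 scale0r addr0.
rewrite (_ : h \o q = fun v => (h \o p) v + (e v - (e \o p) v) * h (a - p a)).
  move=> v; apply: cvgD; first exact: pc.
  apply: cvgMr_tmp; apply: cvgB; first exact: clinear_continuous.
  exact: pc.
apply/funext => v /=; rewrite qE [h (_ + _)]linearD [h (_ *: _)]linearZ /=.
by rewrite [e (_ - _)]linearB.
Qed.

End topological_vector_space.

(** * Baire category in Frechet spaces *)

Section frechet_spaces.
Context {R : realType}.

(** The only consequences of metrizability and completeness that are used: a
    countable base of convex symmetric neighbourhoods of 0, such that every
    series whose terms lie in the successive members of the base converges. The
    [k]-th one is contained in the ball of radius [2^-k]. *)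
Lemma frechet_base (V : tvsType R) : frechet V ->
  exists B : nat -> set V,
    (forall k, [/\ nbhs 0 (B k), convex_set (B k) & forall v, B k v -> B k (- v)]) /\
    (forall U, nbhs 0 U -> \forall k \near \oo, B k `<=` U) /\
    (forall u : nat -> V, (forall k, B k (u k.+1 - u k)) ->
       exists l : V, u @ \oo --> l).
Proof.
move=> [d [[d0 dC dT] [dD dnbhs dcomplete]]].
pose q k : R := 2^-1 ^+ k.
have q0 k : 0 < q k by rewrite exprn_gt0// invr_gt0.
have qS k : q k.+1 = q k / 2 by rewrite /q exprSr.
have qsmall (e : R) : 0 < e -> \forall k \near \oo, q k < e.
  move=> e0; have : q k @[k --> \oo] --> (0 : R).
    by apply: cvg_expr; rewrite ger0_norm ?invr_ge0// invf_lt1// ltr1n.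
  move=> /cvgrPdist_lt/(_ _ e0); apply: filterS => k.
  by rewrite sub0r normrN gtr0_norm.
have /choice[B HB] k : exists W : set V,
    [/\ nbhs 0 W, convex_set W, forall v, W v -> W (- v) &
        forall v, W v -> d 0 v < q k].
  have [] := @nbhs0_absconvex _ _ [set v : V | d 0 v < q k].
    by apply/dnbhs; exists (q k).
  by move=> W W0 [Wd Wc Wn]; exists W; split.
exists B; split; [|split].
- by move=> k; have [] := HB k.
- move=> U /dnbhs[e e0 eU]; apply: filterS (qsmall e e0) => k ke v Bv.
  by apply: eU => /=; have [_ _ _ /(_ _ Bv)/lt_trans->] := HB k.
- move=> u uB; apply: dcomplete => e e0.
  have step k : d (u k) (u k.+1) <= q k.
    have [_ _ _ /(_ _ (uB k))/ltW] := HB k.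
    by rewrite -(dD _ _ (u k)) add0r subrK.
  have far N p : d (u N) (u (N + p)%N) <= 2 * q N - 2 * q (N + p)%N.
    elim: p => [|p IHp].
      by rewrite addn0 subrr; have [_ ->] := d0 (u N) (u N).
    rewrite addnS; have := dT (u N) (u (N + p)%N) (u (N + p).+1).
    have := step (N + p)%N; have := qS (N + p)%N.
    by lra.
  have [N _ qN] : \forall k \near \oo, q k < e / 4 by apply: qsmall; lra.
  have near0 m : (N <= m)%N -> d (u N) (u m) < e / 2.
    move=> /subnKC <-; have := far N (m - N)%N.
    have := q0 (N + (m - N))%N; have := qN N (leqnn N); rewrite /=.
    by lra.
  exists N => m n /near0 mN /near0 nN.
  have := dT (u m) (u N) (u n); rewrite (dC (u m) (u N)).
  by lra.
Qed.

(** If no [A n] has interior in [M], which they cover, a decreasing sequence of neighbourhoods can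
    be built, the closure of the [n]-th avoiding [A n]; their centres lie in [M]
    and converge, by the choice of [B], to a point of [M] that lies in no [A n]. *)
Lemma frechet_baire (V : tvsType R) (M : set V) (A : nat -> set V) :
  frechet V -> closed M -> M !=set0 -> (forall n, closed (A n)) ->
  M `<=` \bigcup_n A n ->
  exists n m U, [/\ M m, nbhs m U & U `&` M `<=` A n].
Proof.
move=> /frechet_base[B [HB [_ Bcvg]]] Mclosed [m0 Mm0] Aclosed MA.
apply: contrapT => nA.
have nbB v k : nbhs v [set w | B k (w - v)].
  have := @nbhs_affine R V 1 (- v) v (B k); rewrite scale1r subrr => /(_ _)/wrap[].
    by have [] := HB k.
  by apply: filterS => w /=; rewrite scale1r.
(* [next] asks nothing of the successor of a bad state, since dependent choice
   needs a successor for every state; bad states are never reached. *)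
pose good (x : nat * V * set V) := M x.1.2 /\ nbhs x.1.2 x.2.
pose next (x y : nat * V * set V) := y.1.1 = x.1.1.+1 /\ (good x ->
  [/\ good y, x.2 y.1.2, closure y.2 `<=` x.2, closure y.2 `<=` ~` A x.1.1 &
      y.2 `<=` [set w | B x.1.1.+1 (w - y.1.2)]]).
have nextP x : {y | next x y}.
  case: x => [[n m] O]; apply: cid.
  have [gx|] := pselect (good (n, m, O)); last by exists (n.+1, m, O).
  have [Mm nO] := gx.
  have [v [Ov Mv Av]] : exists v, [/\ interior O v, M v & ~ A n v].
    apply: contrapT => nbv; apply: nA; exists n, m, (interior O); split=> //.
      exact: nbhs_interior.
    by move=> v [Ov Mv]; apply: contrapT => Av; apply: nbv; exists v.
  have nbv : nbhs v (O `&` ~` A n `&` [set w | B n.+1 (w - v)]).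
    apply: filterI => //; apply: filterI => //.
    by apply: open_nbhs_nbhs; split=> //; exact: closed_openC.
  have [W nW Wsub] := @uniform_regular V v _ nbv.
  exists (n.+1, v, W); split=> // _; split=> //=.
  - exact: nbhs_singleton.
  - by move=> w /Wsub[[]].
  - by move=> w /Wsub[[]].
  - by move=> w /subset_closure/Wsub[].
have [f [f0 fS]] := dependent_choice nextP (0%N, m0, [set w | B 0%N (w - m0)]).
have fn n : (f n).1.1 = n by elim: n => [|n IH]; [rewrite f0|rewrite (fS n).1 IH].
have fgood n : good (f n).
  elim: n => [|n IH]; first by rewrite f0; split=> //=.
  by have [] := (fS n).2 IH.
have sub n j : (n <= j)%N -> (f j).2 `<=` (f n).2.
  move=> /subnKC <-; elim: (j - n)%N => [|p IH]; first by rewrite addn0.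
  rewrite addnS; apply: subset_trans IH.
  have [_ _ c _ _] := (fS (n + p)%N).2 (fgood _).
  by apply: subset_trans c; exact: subset_closure.
have inball n : (f n).2 `<=` [set w | B n (w - (f n).1.2)].
  case: n => [|n]; first by rewrite f0.
  by have [_ _ _ _] := (fS n).2 (fgood n); rewrite fn.
have [l ul] : exists l : V, (f n).1.2 @[n --> \oo] --> l.
  apply: Bcvg => k; apply: inball.
  by have [_ ? _ _ _] := (fS k).2 (fgood k).
have Ml : M l.
  by apply: (closed_cvg M Mclosed _ _ ul); apply: nearW => n; have [] := fgood n.
have [n _] := MA _ Ml.
have [_ _ _ + _] := (fS n).2 (fgood n); rewrite fn; apply.
apply: (closed_cvg (closure (f n.+1).2)) ul; first exact: closed_closure.
exists n.+1 => // j /= nj; apply: subset_closure; apply: sub nj _ _.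
by apply: nbhs_singleton; have [] := fgood j.
Qed.

End frechet_spaces.

(** * Open mapping theorem for closed convex relations *)

Section open_relation.
Context {R : realType} {X Z : tvsType R}.

Lemma closure_convex_comb (P : set Z) (t : R) (w p : Z) :
  convex_set P -> 0 <= t -> t <= 1 -> closure P w -> P p ->
  closure P (t *: w + (1 - t) *: p).
Proof.
move=> /convex_setP Pc t0 t1 clw Pp B nB.
have [u [Pu Bu]] := clw _ (nbhs_affine nB).
by exists (t *: u + (1 - t) *: p); split=> //; exact: Pc.
Qed.

(** With [N] shrunk to a convex neighbourhood, the image [P] of [x0 + N] under
    [L] is convex and absorbing in [M], so that by Baire its closure has a point
    [m'] interior relative to [M]. As [P] contains a negative multiple of [m'],
    the closure of [P] is a neighbourhood of 0 in [M]. *)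
Lemma convex_relation_almost_open (L : set (X * Z)) (M : set Z) (x0 : X)
    (N : set X) :
  frechet Z -> convex_set L -> linear_subspace M -> closed M ->
  (forall x z, L (x, z) -> M z) -> L (x0, 0) ->
  (forall z, M z -> exists2 t, 0 < t & exists x, L (x, t *: z)) ->
  nbhs 0 N ->
  exists2 U, nbhs 0 U & forall z, U z -> M z ->
    closure [set w | exists2 x, N (x - x0) & L (x, w)] z.
Proof.
move=> frZ /convex_setP Lc [M0 Mlin] Mclosed LM L0 Labs N0.
have [W W0 [WN /convex_setP Wc Wsym]] := nbhs0_absconvex N0.
have MZ t v : M v -> M (t *: v).
  by move=> Mv; rewrite -[_ *: v]addr0; exact: Mlin.
have MD u v : M u -> M v -> M (u + v).
  by move=> Mu Mv; rewrite -[u]scale1r; exact: Mlin.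
pose P := [set w | exists2 x, W (x - x0) & L (x, w)].
have Pc : convex_set P.
  apply/convex_setP => t u v t0 t1 [x Wx Lx] [y Wy Ly].
  exists (t *: x + (1 - t) *: y); last exact: (Lc t (x, u) (y, v)).
  have -> : t *: x + (1 - t) *: y - x0 = t *: (x - x0) + (1 - t) *: (y - x0).
    by rewrite !scalerBr addrACA -opprD -scalerDl (addrC t) subrK scale1r.
  exact: Wc.
have P0 : P 0 by exists x0 => //; rewrite subrr; exact: nbhs_singleton.
have Pabs z : M z -> exists2 s, 0 < s & forall r, 0 <= r -> r <= s -> P (r *: z).
  move=> Mz; have [t t0 [x Lx]] := Labs _ Mz.
  have [e e0 eW] := nbhs0_absorbs (x - x0) W0.
  exists (t * Num.min 1 (e / 2)).
    by rewrite mulr_gt0// lt_min ltr01 divr_gt0.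
  move=> r r0; rewrite -ler_pdivrMl// le_min => /andP[h1 he].
  have h0 : 0 <= t^-1 * r by rewrite mulr_ge0// invr_ge0 ltW.
  exists (t^-1 * r *: x + (1 - t^-1 * r) *: x0).
    have -> : t^-1 * r *: x + (1 - t^-1 * r) *: x0 - x0 = (t^-1 * r) *: (x - x0).
      by rewrite scalerBl scale1r scalerBr addrA addrAC addrK.
    by apply: eW; rewrite ger0_norm//; lra.
  have := Lc _ _ _ h0 h1 Lx L0; congr L; congr (_, _) => /=.
  by rewrite scaler0 addr0 scalerA mulrAC mulVf ?gt_eqF// mul1r.
pose A n := [set z | closure P (n.+1%:R^-1 *: z + 0)].
have [n [m [D [Mm nD DA]]]] : exists n m D, [/\ M m, nbhs m D & D `&` M `<=` A n].
  apply: (@frechet_baire R Z M A) => //; first by exists 0.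
    move=> n; apply: (@closed_comp _ _ (fun z => n.+1%:R^-1 *: z + 0)).
      by move=> z _; exact: affine_continuous.
    exact: closed_closure.
  move=> z /Pabs[s s0 sP]; have [n _ ns] := near_infty_natSinv_lt (PosNum s0).
  exists n => //; apply: subset_closure; rewrite addr0; apply: sP => //.
  by rewrite ltW// ns/=.
pose m' := n.+1%:R^-1 *: m.
have [s s0 Ps] := Pabs _ (MZ (-1) _ (MZ n.+1%:R^-1 _ Mm)).
have {Ps} Ps : P (- (s *: m')).
  by have := Ps s (ltW s0) (lexx s); rewrite scaleN1r scalerN.
pose a := n.+1%:R * ((1 + s) / s).
exists [set z | D (a *: z + m)].
  by apply: nbhs_affine; rewrite scaler0 add0r.
move=> z Dz Mz.
have clP : closure P (n.+1%:R^-1 *: (a *: z + m) + 0).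
  by apply: DA; split=> //; apply: MD => //; exact: MZ.
have n0 : n.+1%:R != 0 :> R by [].
have s1 : 1 + s != 0 by rewrite gt_eqF// addr_gt0.
have sn0 : s != 0 by rewrite gt_eqF.
have e : 1 - s / (1 + s) = (1 + s)^-1.
  by apply: (mulIf s1); rewrite mulrBl mulfVK// mulVf// mul1r addrK.
have t0 : 0 <= s / (1 + s) by rewrite divr_ge0// ltW// addr_gt0.
have t1 : s / (1 + s) <= 1.
  by rewrite ler_pdivrMr ?addr_gt0// mul1r lerDr.
have := closure_convex_comb Pc t0 t1 clP Ps.
have -> : s / (1 + s) *: (n.+1%:R^-1 *: (a *: z + m) + 0) +
    (1 - s / (1 + s)) *: - (s *: m') = z.
  have ea : s / (1 + s) * (n.+1%:R^-1 * a) = 1.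
    by rewrite /a mulKf// mulrA mulfVK// divff.
  rewrite e addr0 [n.+1%:R^-1 *: _]scalerDr -/m' scalerA scalerDr scalerA ea.
  by rewrite scale1r scalerN [_ *: (s *: m')]scalerA [_^-1 * s]mulrC addrK.
by apply: closureS => w [x Wx Lx]; exists x => //; exact: WN.
Qed.

(** The Robinson-Ursescu theorem at a point of the graph. A point [z] of [M]
    close to 0 is written as a series of terms [2^-(k+1) z_k], each [z_k] being
    related to some [x_k] whose distance to [x0] tends to 0: almost openness
    lets [z_k] absorb half of the remainder. The corresponding series of terms
    [2^-(k+1) x_k] converges by completeness of [X], and its sum is related
    to [z] since [L] is closed and convex. *)
Lemma closed_convex_relation_open (L : set (X * Z)) (M : set Z) (x0 : X) :
  frechet X -> frechet Z -> closed L -> convex_set L ->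
  linear_subspace M -> closed M ->
  (forall x z, L (x, z) -> M z) -> L (x0, 0) ->
  (forall z, M z -> exists2 t, 0 < t & exists x, L (x, t *: z)) ->
  exists2 U, nbhs 0 U & forall z, U z -> M z -> exists x, L (x, z).
Proof.
move=> frX frZ Lclosed Lconv Msub Mclosed LM L0 Labs.
have [BX [HX [_ Xcvg]]] := frechet_base frX.
have [BZ [HZ [Znear _]]] := frechet_base frZ.
have [M0 Mlin] := Msub.
have MZ t v : M v -> M (t *: v).
  by move=> Mv; rewrite -[_ *: v]addr0; exact: Mlin.
have MB u v : M u -> M v -> M (u - v).
  by move=> Mu Mv; rewrite addrC -scaleN1r; exact: Mlin.
have /choice[Q HQ] k : exists Q : set Z, [/\ nbhs 0 Q, Q `<=` BZ k &
    forall z, Q z -> M z ->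
      closure [set w | exists2 x, BX k (x - x0) & L (x, w)] z].
  have [BX0 _ _] := HX k; have [BZ0 _ _] := HZ k.
  have [U U0 HU] :=
    convex_relation_almost_open frZ Lconv Msub Mclosed LM L0 Labs BX0.
  by exists (U `&` BZ k); split; [exact: filterI|move=> z []|move=> z [/HU]].
move: Lconv => /convex_setP Lc.
exists [set z | Q 0%N (2 *: z + 0)].
  by apply: nbhs_affine; rewrite scaler0 addr0; have [] := HQ 0%N.
move=> z; rewrite /= addr0 => Qz Mz.
pose q k : R := 2^-1 ^+ k.
have q0 k : 0 < q k by rewrite exprn_gt0// invr_gt0.
have q1 k : q k <= 1 by rewrite exprn_ile1// ?invr_ge0// invf_le1// ler1n.
have qS k : q k.+1 = q k / 2 by rewrite /q exprSr.
(* In a state [(k, w, s)], the remainder of the series for [z] is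
   [2^-(k+1) *: w] and [s] is its partial sum in [X], completed by [2^-k *: x0]
   to have total weight 1. The last condition says that the partial sums,
   completed by any pair of [L] with weight [2^-k], are a pair of [L]. *)
pose good (y : nat * Z * X) := [/\ M y.1.2, Q y.1.1 y.1.2 &
  forall x z', L (x, z') ->
    L (y.2 + q y.1.1 *: (x - x0), z - q y.1.1.+1 *: y.1.2 + q y.1.1 *: z')].
pose next (y y' : nat * Z * X) := y'.1.1 = y.1.1.+1 /\ (good y ->
  good y' /\ BX y.1.1 (y'.2 - y.2)).
have nextP y : {y' | next y y'}.
  case: y => [[k w] s]; apply: cid.
  have [gy|] := pselect (good (k, w, s)); last by exists (k.+1, w, s).
  have [/= Mw Qw Ls] := gy.
  have [_ _ /(_ _ Qw Mw) clw] := HQ k.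
  have nw : nbhs w [set v | Q k.+1 (2 *: w + - (2 *: v))].
    have : nbhs w [set v | Q k.+1 (- 2 *: v + 2 *: w)].
      by apply: nbhs_affine; rewrite scaleNr addNr; have [] := HQ k.+1.
    by apply: filterS => v /=; rewrite scaleNr addrC.
  have [v [[x Bx Lx] Qv]] := clw _ nw.
  have Mv : M v := LM _ _ Lx.
  exists (k.+1, 2 *: w - 2 *: v, s + q k.+1 *: (x - x0)).
  split=> // _; split; last first.
    rewrite /= addrC addKr.
    have [BX0 /convex_setP BXc _] := HX k.
    have := BXc (q k.+1) _ 0 (ltW (q0 _)) (q1 _) Bx (nbhs_singleton BX0).
    by rewrite scaler0 addr0.
  split=> //=; first by apply: MB; exact: MZ.
  move=> y z' Ly.
  have h0 : 0 <= 2^-1 :> R by rewrite invr_ge0.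
  have h1 : 2^-1 <= 1 :> R by rewrite invf_le1// ler1n.
  have := Ls _ _ (Lc _ _ _ h0 h1 Lx Ly).
  have -> : 1 - 2^-1 = 2^-1 :> R by lra.
  congr L; congr (_, _) => /=.
    rewrite -[RHS]addrA -[in RHS]scalerDr qS -scalerA addrACA -opprD.
    congr (_ + _ *: _); rewrite scalerBr scalerDr [2^-1 *: (x0 + x0)]scalerDr.
    rewrite -[2^-1 *: x0 + _]scalerDl.
    have -> : 2^-1 + 2^-1 = 1 :> R by lra.
    by rewrite scale1r.
  have -> : q k.+2 *: (2 *: w - 2 *: v) = q k.+1 *: (w - v).
    by rewrite -scalerBr scalerA qS mulfVK.
  rewrite scalerDr !scalerA -qS scalerBr opprB !addrA; congr (_ + _).
  by rewrite addrAC.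
have [f [f0 fS]] := dependent_choice nextP (0%N, 2 *: z, x0).
have fn n : (f n).1.1 = n by elim: n => [|n IH]; [rewrite f0|rewrite (fS n).1 IH].
have fgood n : good (f n).
  elim: n => [|n IH]; last by have [] := (fS n).2 IH.
  rewrite f0; split=> //=; first exact: MZ.
  move=> x z' Lx; rewrite /q expr0 expr1 !scale1r scalerA mulVf// scale1r.
  by rewrite subrr add0r addrC subrK.
have [l sl] : exists l : X, (f n).2 @[n --> \oo] --> l.
  by apply: Xcvg => k; have [_] := (fS k).2 (fgood k); rewrite fn.
exists l.
pose c n := z - q n.+1 *: (f n).1.2.
have cz : c n @[n --> \oo] --> z.
  move=> D nD.
  have : nbhs 0 [set v | D (- 1 *: v + z)].
    by apply: nbhs_affine; rewrite scaler0 add0r.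
  move=> /Znear; apply: filterS => n Bn.
  rewrite /= /c addrC -scaleN1r; apply: Bn.
  have [BZ0 /convex_setP BZc _] := HZ n.
  have Bw : BZ n (f n).1.2.
    by have [_ QB _] := HQ n; apply: QB; have [_ + _] := fgood n; rewrite fn.
  have := BZc (q n.+1) _ 0 (ltW (q0 _)) (q1 _) Bw (nbhs_singleton BZ0).
  by rewrite scaler0 addr0.
apply: (closed_cvg L Lclosed _ (l, z) (cvg_pair sl cz)).
apply: nearW => n; have [_ _ /(_ _ _ L0)] := fgood n.
by rewrite fn subrr !scaler0 !addr0.
Qed.

End open_relation.

(** * Convex cones with interior, and the weak supremum *)

Section ordering_cone.
Context {R : realType} {Y : tvsType R} (K : set Y).
Context (Kconvex : convex_set K) (Kcone : cone K).

Lemma cone0 : K !=set0 -> K 0.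
Proof. by move=> [u /(Kcone (lexx 0))]; rewrite scale0r. Qed.

Lemma convex_coneD u v : K u -> K v -> K (u + v).
Proof.
move=> Ku Kv; have /convex_setP Kc := Kconvex.
have h0 : 0 <= 2^-1 :> R by rewrite invr_ge0.
have h1 : 2^-1 <= 1 :> R by rewrite invf_le1// ler1n.
have /Kcone : 0 <= 2 :> R by [].
move=> /(_ _ (Kc _ _ _ h0 h1 Ku Kv)).
have -> : 1 - 2^-1 = 2^-1 :> R by lra.
by rewrite -scalerDr scalerA mulfV// scale1r.
Qed.

Lemma interior_coneD u v : interior K u -> K v -> interior K (u + v).
Proof.
move=> Ku Kv; have : nbhs (u + v) [set w | K (1 *: w + - v)].
  by apply: nbhs_affine; rewrite scale1r addrK.
apply: filterS => w /=; rewrite scale1r => Kw.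
by rewrite -[w](subrK v); exact: convex_coneD.
Qed.

Lemma interior_coneZ (t : R) u : 0 < t -> interior K u -> interior K (t *: u).
Proof.
move=> t0 Ku; have : nbhs (t *: u) [set w | K (t^-1 *: w + 0)].
  by apply: nbhs_affine; rewrite addr0 scalerA mulVf ?gt_eqF// scale1r.
apply: filterS => w /=; rewrite addr0 => /(Kcone (ltW t0)).
by rewrite scalerA mulfV ?gt_eqF// scale1r.
Qed.

Lemma interior_moves u w : interior K u ->
  exists2 e : R, 0 < e & forall t, `|t| < e -> interior K (u + t *: w).
Proof.
move=> Ku; have : nbhs 0 [set v | interior K (1 *: v + u)].
  by apply: nbhs_affine; rewrite scaler0 add0r; exact: nbhs_interior.
move=> /(nbhs0_absorbs w)[e e0 he]; exists e => // t /he.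
by rewrite /= scale1r addrC.
Qed.

Lemma interior_dominates k0 w : interior K k0 ->
  exists2 r : R, 0 <= r & interior K (r *: k0 + w).
Proof.
move=> /(interior_moves w)[e e0 /(_ (e / 2))].
rewrite ger0_norm ?divr_ge0// ?ltW// => /(_ _)/wrap[]; first by lra.
have i0 : 0 < (e / 2)^-1 by rewrite invr_gt0 divr_gt0.
move=> /(interior_coneZ i0).
rewrite scalerDr scalerA mulVf ?scale1r; last by rewrite -invr_eq0 gt_eqF.
by exists (e / 2)^-1 => //; exact: ltW.
Qed.

Lemma wlt_finite (u v : Y) : wlt K u%:E v%:E <-> interior K (v - u).
Proof.
rewrite /wlt; split=> [[w Kw wE]|Kuv]; first by rewrite -opprB -wE opprK.
by exists (v - u) => //; rewrite opprB.
Qed.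

End ordering_cone.

Section conjugate_epigraph.
Context {R : realType} {X Y : tvsType R} (K : set Y).
Context (Kconvex : convex_set K) (Kcone : cone K) (Kint : interior K !=set0).
Context (F : X -> \bar Y) (FNy : forall x, F x <> -oo%E).

Lemma epi_finiteP x (w : Y) :
  epi K F (x, w) <-> exists f k, [/\ F x = f%:E, K k & w = f + k].
Proof.
split=> [[_ -> [k Kk]]|[f [k [Ff Kk ->]]]].
  by case: (F x) => // f [<-]; exists f, k.
by exists f%:E; [rewrite /= Ff|exists k].
Qed.

Lemma epi_graph x f : F x = f%:E -> epi K F (x, f).
Proof.
move=> Fx; apply/epi_finiteP; exists f, 0; rewrite addr0; split=> //.
by apply: cone0 => //; have [k /interior_subset Kk] := Kint; exists k.
Qed.

Lemma dom_finiteP x : dom F x <-> exists f, F x = f%:E.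
Proof.
split=> [|[f Ff]]; last by rewrite /dom /= Ff.
by rewrite /dom/=; have := @FNy x; case: (F x) => // f _ _; exists f.
Qed.

(** A point [y] that is strictly below no [L x - F x] dominates an element of
    the weak supremum, namely the last point with this property on the half-line
    from [y] in the direction of [- k0], for [k0] interior to [K]. *)
Lemma epi_conjugateP (L : clinear X Y) (y : Y) : dom F !=set0 ->
  epi_conjugate K F (L, y) <->
  forall x f, F x = f%:E -> ~ interior K (L x - f - y).
Proof.
move=> [x0 /dom_finiteP[f0 Ff0]]; have [k0 Kk0] := Kint.
split.
  move=> [v [vub _] [k Kk vky]] x f Ff Kx.
  case: v vub vky => // v vub [vky].
  apply: (vub (L x - f)%:E); first by exists x => //; rewrite Ff.
  have vE : L x - f - v = L x - f - y + k by rewrite -vky opprD addrA subrK.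
  by apply/wlt_finite; rewrite vE; exact: interior_coneD.
move=> noy.
pose D t := exists x f, F x = f%:E /\ interior K (L x - f - t).
pose A := [set s : R | 0 <= s /\ D (y - s *: k0)].
have A0 : A !=set0.
  have [r r0 Kr] := interior_dominates Kcone (L x0 - f0 - y) Kk0.
  exists r; split=> //; exists x0, f0; split=> //.
  by rewrite opprB addrCA.
have [s [s0 sA As]] : exists s, [/\ 0 <= s, forall r, A r -> s <= r &
    forall e, 0 < e -> exists2 r, A r & r < s + e].
  have infA : has_inf A by split=> //; exists 0 => s [].
  exists (inf A); split; first by apply: lb_le_inf => // r [].
    exact: ge_inf infA.2.
  by move=> e e0; exact: inf_adherent.
exists (y - s *: k0)%:E; last first.
  exists (s *: k0); last exact: (congr1 EFin (subrK _ _)).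
  by apply: Kcone => //; exact: interior_subset.
split.
- move=> _ [x _ <-]; case Ff : (F x) => [f| |] //; last first.
    by case: (FNy Ff).
  move=> /wlt_finite Kx; have [e e0 Ke] := interior_moves k0 Kx.
  have [sz|sz] := eqVneq s 0.
    by apply: (noy x f Ff); move: Kx; rewrite sz scale0r subr0.
  have sp : 0 < s by rewrite lt_neqAle eq_sym sz.
  pose t := Num.min s (e / 2).
  have t0 : 0 < t by rewrite lt_min sp divr_gt0.
  have ts : t <= s by rewrite ge_min lexx.
  have te : t <= e / 2 by rewrite ge_min lexx orbT.
  have : A (s - t).
    split; first by rewrite subr_ge0.
    exists x, f; split=> //.
    have := Ke (- t); rewrite normrN gtr0_norm// => /(_ _)/wrap[]; first by lra.
    congr (interior K _).
    by rewrite scaleNr scalerBl -[LHS]addrA !opprB [s *: k0 - y - _]addrAC.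
  by move=> /sA; lra.
- move=> [t| |] //; last first.
    by move=> _; exists (L x0 - f0)%:E => //; exists x0 => //; rewrite Ff0.
  move=> /wlt_finite Kt; have [e e0 Ke] := interior_moves k0 Kt.
  have [r [r0 [x [f [Ff Kr]]]] rs] := As _ e0.
  exists (L x - f)%:E; first by exists x => //; rewrite Ff.
  apply/wlt_finite.
  have sr : s <= r by apply: sA; split=> //; exists x, f.
  have := Ke (s - r); rewrite ler0_norm ?subr_le0// opprB ltrBlDl.
  move=> /(_ rs)/interior_subset/(interior_coneD Kconvex Kcone Kr).
  congr (interior K _); rewrite scalerBl.
  by rewrite [y - _ - t + _]addrAC [y - _ + _]addrA subrK [LHS]addrA subrK.
Qed.

End conjugate_epigraph.

(** * Vector Lagrange multipliers *)

Section vector_separation.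
Context {R : realType} {Y : tvsType R} {Z : lmodType R}.
Context (K : set Y) (k0 : Y) (Kcone : cone K) (Kk0 : interior K k0).

(** Both multipliers come from a single minorant on [Y * Z], of the convex
    function whose value at [(v, z)] is the infimum of the [r] with
    [(r *: k0 + v, z)] in [Q]; moving along [k0] normalizes [ys]. The hypotheses on [Q] say that it
    has no point [(v, 0)] with [- v] interior to [K], and that its projection to [Z] is
    absorbing in the subspace that it spans. *)
Lemma vector_lagrange_multipliers (Q : set (Y * Z)) :
  convex_set Q -> Q !=set0 ->
  (forall v z k, Q (v, z) -> K k -> Q (v + k, z)) ->
  (forall v, Q (v, 0) -> ~ interior K (- v)) ->
  (forall v z, Q (v, z) -> exists2 t : R, 0 < t & exists v', Q (v', - (t *: z))) ->
  exists (ys : {linear Y -> R^o}) (zs : {linear Z -> R^o}),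
    [/\ ys k0 = 1, forall k, K k -> 0 <= ys k &
        forall v z, Q (v, z) -> 0 <= ys v + zs z].
Proof.
move=> /convex_setP Qc [[v0 z0] Q0] Qup Qneg Qcore.
have [|||h hP] := @convex_minorant R (Y * Z)%type
    (fun r p => Q (r *: k0 + p.1, p.2)).
- apply/convex_setP => t [r1 [v1 z1]] [r2 [v2 z2]] t0 t1 Q1 Q2 /=.
  have := Qc t _ _ t0 t1 Q1 Q2; congr Q; congr (_, _) => /=.
  by rewrite !scalerDr !scalerA addrACA -scalerDl.
- move=> r; rewrite /= addr0 => Qr; rewrite leNgt; apply/negP => r0.
  apply: Qneg Qr _; rewrite -scaleNr; apply: interior_coneZ => //.
  by rewrite oppr_gt0.
- move=> r [v z] /= /Qcore[t t0 [v' Qv']]; exists t => //.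
  have [r' _ /interior_subset Kr'] :=
    interior_dominates Kcone (- (t *: v) - v') Kk0.
  exists r'; have := Qup _ _ _ Qv' Kr'.
  by rewrite addrC addrA subrK.
have [ys ysE] : exists ys : {linear Y -> R^o}, forall v, ys v = - h (v, 0).
  apply: linear_of_fun => l u v.
  have -> : (l *: u + v, 0) = l *: (u, 0) + (v, 0) :> Y * Z.
    by congr (_, _); rewrite /= scaler0 addr0.
  by rewrite linearP opprD scalerN.
have [zs zsE] : exists zs : {linear Z -> R^o}, forall z, zs z = - h (0, z).
  apply: linear_of_fun => l u v.
  have -> : (0, l *: u + v) = l *: (0, u) + (0, v) :> Y * Z.
    by congr (_, _); rewrite /= scaler0 addr0.
  by rewrite linearP opprD scalerN.
have key v z r : Q (v, z) -> 0 <= r * (1 - ys k0) + (ys v + zs z).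
  move=> Qv; have : h (v - r *: k0, z) <= r by apply: hP; rewrite /= addrC subrK.
  have -> : (v - r *: k0, z) = - r *: (k0, 0) + ((v, 0) + (0, z)) :> Y * Z.
    by congr (_, _); rewrite /= ?scaler0 ?addr0 ?add0r// scaleNr addrC.
  rewrite linearP linearD/= ysE zsE ysE /GRing.scale/=; lra.
have ys1 : ys k0 = 1.
  have h1 : 0 <= 1 - ys k0.
    apply: (@ray_slope_ge0 _ (ys v0 + zs z0)) => t _.
    by rewrite addrC; exact: key.
  have h2 : 0 <= - (1 - ys k0).
    apply: (@ray_slope_ge0 _ (ys v0 + zs z0)) => t _.
    by rewrite addrC mulrN -mulNr; exact: key.
  by apply/eqP; rewrite eq_le; lra.
have pos v z : Q (v, z) -> 0 <= ys v + zs z.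
  by move=> /(key _ _ 0); rewrite mul0r add0r.
exists ys, zs; split=> // k Kk.
apply: (@ray_slope_ge0 _ (ys v0 + zs z0)) => t t0.
have := pos _ _ (Qup _ _ _ Q0 (Kcone t0 Kk)).
by rewrite linearD linearZ/= addrAC.
Qed.

Lemma positive_linear_continuous (ys : {linear Y -> R^o}) :
  (forall k, K k -> 0 <= ys k) -> continuous ys.
Proof.
move=> ysK.
apply: (@linear_lower_bounded_continuous _ _ ys [set v | K (1 *: v + k0)] (ys k0)).
  by apply: nbhs_affine; rewrite scaler0 add0r.
by move=> v /= /ysK; rewrite scale1r linearD/=; lra.
Qed.

Lemma positive_linear_interior (ys : {linear Y -> R^o}) v :
  (forall k, K k -> 0 <= ys k) -> 0 < ys k0 -> interior K v -> 0 < ys v.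
Proof.
move=> ysK ys0 /(interior_moves k0)[e e0 /(_ (- (e / 2)))].
rewrite normrN gtr0_norm ?divr_gt0// => /(_ _)/wrap[]; first by lra.
move=> /interior_subset/ysK; rewrite linearD linearZ/= /GRing.scale/=.
have : 0 < e / 2 * ys k0 by rewrite !mulr_gt0// invr_gt0.
by lra.
Qed.

End vector_separation.

(** * Convex programs and their constraint qualifications *)

Lemma closed_sublevel (R : realType) (X : topologicalType) (f : X -> \bar R)
    (b : X -> R^o) :
  lower_semicontinuous f -> continuous b -> closed [set x | (f x <= (b x)%:E)%E].
Proof.
move=> flsc bcont x clx; rewrite /= leNgt; apply/negP => bf.
have [a ba af] : exists2 a, b x < a & (a%:E < f x)%E.
  case: (f x) bf => [r| |] //.
    rewrite lte_fin => br; exists ((b x + r) / 2); first by lra.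
    by rewrite lte_fin; lra.
  by move=> _; exists (b x + 1); [lra|rewrite ltry].
have [N nN fN] := flsc _ _ af.
have nb : nbhs x [set u | b u < a].
  have /cvgrPdist_lt/(_ (a - b x)) := bcont x.
  rewrite subr_gt0 => /(_ ba); apply: filterS => u /=.
  by rewrite distrC => /ltr_normlW; lra.
have [u [/= ub [Nu bu]]] := clx _ (filterI nN nb).
have := lt_le_trans (fN _ Nu) ub; rewrite lte_fin.
by move: bu => /=; lra.
Qed.

Lemma epi_convex_comb (R : realType) (X W : tvsType R) (U : set W) (H : X -> \bar W) t x1 w1 x2 w2 :
  cone_convex U H -> 0 <= t -> t <= 1 ->
  epi U H (x1, w1) -> epi U H (x2, w2) ->
  epi U H (t *: x1 + (1 - t) *: x2, t *: w1 + (1 - t) *: w2).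
Proof. by move=> /convex_setP Hc t0 t1; exact: Hc. Qed.

Section cone_convex_program.
Context {R : realType} {X Y Z : tvsType R}.
Context {K : set Y} {S : set Z} {C : set X} {F : X -> \bar Y} {G : X -> \bar Z}.
Context (Kconvex : convex_set K) (Kcone : cone K) (Kint : interior K !=set0).
Context (Cconvex : convex_set C).
Context (FNy : forall x, F x <> -oo%E) (Fconvex : cone_convex K F).
Context (GNy : forall x, G x <> -oo%E) (Gconvex : cone_convex S G).

(** The levels of relaxation [z] at which the constraint [G x <= z] is feasible. *)
Definition attainable : set Z :=
  EFin @^-1` addset (G @` (C `&` dom F `&` dom G)) S.
Local Notation E := attainable.

Lemma attainableP z :
  E z <-> exists x, [/\ C x, dom F x & epi S G (x, z)].
Proof.
split.
  move=> [_ [x [[Cx Fx] _] <-] [s Ss]]; have := @GNy x.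
  case Gx : (G x) => [g| |] // _ [gsz]; exists x; split=> //.
  by apply/epi_finiteP; exists g, s.
move=> [x [Cx Fx /epi_finiteP[g [s [Gx Ss zE]]]]].
exists (G x); first by exists x => //; split=> //; rewrite /dom /= Gx.
by exists s => //; rewrite Gx zE.
Qed.

Section multipliers.
Context (L : clinear X Y) (y : Y).
Context (no_better : forall x f, C x -> (EFin @` (-%R @` S)) (G x) ->
  F x = f%:E -> ~ interior K (L x - f - y)).
Context (E0 : E 0) (Ecore : forall z, E z -> exists2 t, 0 < t & E (- (t *: z))).
Context (k0 : Y) (Kk0 : interior K k0).

(** The set to be separated consists of the pairs
    [(F x + y - L x + k, G x + s)]. Writing it with the two epigraphs makes its
    convexity that of [epi K F] and [epi S G]. *)
Lemma program_multipliers :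
  exists (ys : {linear Y -> R^o}) (zs : {linear Z -> R^o}),
    [/\ ys k0 = 1, forall k, K k -> 0 <= ys k &
        forall x f z, C x -> F x = f%:E -> epi S G (x, z) ->
          0 <= ys (f + y - L x) + zs z].
Proof.
pose Q : set (Y * Z) := [set p | exists x,
  [/\ C x, epi K F (x, p.1 - y + L x) & epi S G (x, p.2)]].
have QE x f z : C x -> F x = f%:E -> epi S G (x, z) -> Q (f + y - L x, z).
  move=> Cx Fx Gx; exists x; split=> //=.
  have -> : f + y - L x - y + L x = f by rewrite addrAC subrK addrK.
  exact: epi_graph.
have [|||||ys [zs [ys1 ysK H]]] := vector_lagrange_multipliers Kcone Kk0 (Q := Q).
- apply/convex_setP => t [v1 z1] [v2 z2] t0 t1 [x1 [C1 F1 G1]] [x2 [C2 F2 G2]].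
  exists (t *: x1 + (1 - t) *: x2); split.
  + by move: Cconvex => /convex_setP; exact.
  + have := epi_convex_comb Fconvex t0 t1 F1 F2.
    congr (epi K F); congr (_, _) => /=.
    rewrite [L (_ + _)]linearD ![L (_ *: _)]linearZ/= !scalerDr !scalerN addrACA.
    congr (_ + _).
    by rewrite addrACA -opprD -scalerDl (addrC t) subrK scale1r.
  + exact: epi_convex_comb Gconvex t0 t1 G1 G2.
- by have /attainableP[x [Cx /(dom_finiteP FNy)[f Fx] Gx]] := E0; exists (f + y - L x, 0); exact: QE.
- move=> v z k [x [Cx /epi_finiteP[f [k' [Fx Kk' vE]]] Gx]] Kk; exists x; split=> //=.
  apply/epi_finiteP; exists f, (k' + k); split=> //; first exact: convex_coneD.
  by rewrite [RHS]addrA -vE /= [v + k - y]addrAC [LHS]addrAC.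
- move=> v [x [Cx /epi_finiteP[f [k [Fx Kk vE]]] /epi_finiteP[g [s [Gx Ss gs0]]]]] Kv.
  apply: (no_better Cx _ Fx).
    exists g => //; exists s => //; apply/eqP.
    by rewrite eq_sym -addr_eq0 -gs0.
  have -> : L x - f - y = - v + k.
    rewrite -[k](addKr f) -vE /= [RHS]addrCA [- v + _]addrA [- v + _]addrA addNr.
    by rewrite add0r [- y + _]addrC addrA [- f + _]addrC.
  exact: interior_coneD.
- move=> v z [x [Cx /epi_finiteP[f [k [Fx _ _]]] Gx]].
  have /Ecore[t t0 /attainableP[x' [Cx' /(dom_finiteP FNy)[f' Fx'] Gx']]] : E z.
    by apply/attainableP; exists x; split=> //; rewrite /dom /= Fx.
  by exists t => //; exists (f' + y - L x'); exact: QE.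
exists ys, zs; split=> // x f z Cx Fx Gx; exact/H/QE.
Qed.

End multipliers.

Section slater.
Context {x0 : X}.
Context (Cx0 : C x0) (Fx0 : dom F x0)
  (Gx0 : (EFin @` (-%R @` interior S)) (G x0)).

Lemma slater_nbhs : nbhs 0 [set z | epi S G (x0, z)].
Proof.
have [_ [s Ss <-] gE] := Gx0.
have : nbhs 0 [set z | S (1 *: z + s)].
  by apply: nbhs_affine; rewrite scaler0 add0r.
apply: filterS => z /= Sz; apply/epi_finiteP; exists (- s), (1 *: z + s).
by split=> //; rewrite scale1r addrC addrK.
Qed.

Lemma slater_core z : exists2 t, 0 < t & E (- (t *: z)).
Proof.
have [e e0 eE] := nbhs0_absorbs (- z) slater_nbhs.
exists (e / 2); first exact: divr_gt0.
apply/attainableP; exists x0; split=> //; rewrite -scalerN.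
by apply: eE; rewrite gtr0_norm ?divr_gt0//; lra.
Qed.

Lemma slater_continuous (L : clinear X Y) (y : Y)
    (ys : {linear Y -> R^o}) (zs : {linear Z -> R^o}) :
  (forall x f z, C x -> F x = f%:E -> epi S G (x, z) ->
          0 <= ys (f + y - L x) + zs z) ->
  continuous zs.
Proof.
move=> H; have /(dom_finiteP FNy)[f Ff] := Fx0.
apply: (linear_lower_bounded_continuous (c := ys (f + y - L x0)) slater_nbhs).
by move=> z /= /(H _ _ _ Cx0 Ff); lra.
Qed.

End slater.

Lemma ri_core z : ri E 0 -> E z -> exists2 t, 0 < t & E (- (t *: z)).
Proof.
move=> [affE0 nE] Ez; have E0 : E 0 := nbhs_singleton nE affE0.
have [e e0 eE] := nbhs0_absorbs (- z) nE.
exists (e / 2); first exact: divr_gt0.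
have := eE (e / 2); rewrite scalerN; apply.
  by rewrite gtr0_norm ?divr_gt0//; lra.
move=> B [Baff EB].
have := Baff (- (e / 2)) z 0 (EB _ Ez) (EB _ E0).
by rewrite scaler0 addr0 scaleNr.
Qed.

(** The projection of [finite_dim_projection] is the identity on [lin E]. *)
Lemma finite_dim_continuous (hZ : hausdorff_space Z) (zs : {linear Z -> R^o}) :
  finite_dim (lin E) -> exists k : clinear Z R^o, forall z, E z -> k z = zs z.
Proof.
move=> [s Es]; have [p [ps pc]] := finite_dim_projection s hZ.
exists (CLinear (clinear_fun := (zs \o p : {linear Z -> R^o})) (pc zs)) => z Ez.
rewrite /=; congr (zs _).
apply: (Es z _ [set v | p v = v]); first by move=> B [_]; apply.
split; last exact: ps.
split; first by rewrite /= linear0.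
by move=> l u v /= pu pv; rewrite linearP pu pv.
Qed.

Lemma sqri_core z : sqri E 0 -> E z -> exists2 t, 0 < t & E (- (t *: z)).
Proof.
move=> [E0 [[_ Wlin] _]] Ez.
have WE v : E v -> [set l *: (v - 0) | l in [set l : R | 0 <= l] & v in E] v.
  by move=> Ev; exists 1; [rewrite /= ler01|exists v => //; rewrite subr0 scale1r].
have [l /= l0 [w Ew]] := Wlin (-1) z 0 (WE _ Ez) (WE _ E0).
rewrite subr0 addr0 scaleN1r => lw.
have [lz|lz] := eqVneq l 0.
  exists 1 => //; move: lw; rewrite lz scale0r => /esym/eqP; rewrite oppr_eq0.
  by move=> /eqP ->; rewrite scaler0 oppr0.
exists l^-1; first by rewrite invr_gt0 lt_neqAle eq_sym lz.
by rewrite -scalerN -lw scalerA mulVf// scale1r.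
Qed.

(** Call [ys (F x + y - L x)] the cost of [x]. The relation between the points
    [x] of [C] of cost at most [c] and the points of [G x + S] is convex, and it
    is closed since the cost is lower semicontinuous. It is therefore open at
    [(x0, 0)] into the closed subspace spanned by [E]: near 0 in that subspace
    every point is attained at cost at most [c], hence [zs] is at least [- c]. *)
Lemma sqri_continuous (L : clinear X Y) (y : Y)
    (ys : {linear Y -> R^o}) (zs : {linear Z -> R^o}) :
  frechet X -> frechet Z -> closed C ->
  (forall y : clinear Y R^o, lower_semicontinuous (lcomp y F : X -> \bar R)) ->
  epi_closed S G -> sqri E 0 ->
  continuous ys -> (forall k, K k -> 0 <= ys k) ->
  (forall x f z, C x -> F x = f%:E -> epi S G (x, z) ->
          0 <= ys (f + y - L x) + zs z) ->
  exists k : clinear Z R^o, forall z, E z -> k z = zs z.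
Proof.
move=> frX frZ Cclosed Flsc Gclosed [E0 [Wlin Wclosed]] ysc ysK H.
set W := [set l *: (v - 0) | l in [set l : R | 0 <= l] & v in E] in Wlin Wclosed.
have EW v : E v -> W v.
  by move=> Ev; exists 1; [rewrite /= ler01|exists v => //; rewrite subr0 scale1r].
have /attainableP[x0 [Cx0 /(dom_finiteP FNy)[f0 Fx0] Gx0]] := E0.
pose c := ys (f0 + y - L x0) + 1.
pose P := [set p : X * Z | [/\ C p.1, epi S G p &
  exists2 f, F p.1 = f%:E & ys (f + y - L p.1) <= c]].
have Pconv : convex_set P.
  apply/convex_setP => t [x1 z1] [x2 z2] t0 t1 /= [C1 G1 [f1 F1 c1]] [C2 G2 [f2 F2 c2]].
  have epiF x f : F x = f%:E -> epi K F (x, f) by exact: epi_graph.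
  have := epi_convex_comb Fconvex t0 t1 (epiF _ _ F1) (epiF _ _ F2).
  move=> /epi_finiteP[f [k [Fx Kk fk]]]; split=> /=.
  - by move: Cconvex => /convex_setP; exact.
  - exact: epi_convex_comb Gconvex t0 t1 G1 G2.
  - exists f => //; have := ysK _ Kk.
    have := congr1 ys fk; move: c1 c2; rewrite !linearB !linearD/= !linearZ/= /GRing.scale/=.
    move=> c1 c2 ysE k_ge0.
    have h1 : t * (ys f1 + ys y - ys (L x1)) <= t * c by rewrite ler_wpM2l.
    have h2 : (1 - t) * (ys f2 + ys y - ys (L x2)) <= (1 - t) * c.
      by rewrite ler_wpM2l// subr_ge0.
    by lra.
have Pclosed : closed P.
  pose b x : R^o := c - ys y + ys (L x).
  have bc : continuous b.
    move=> x; apply: cvgD; first exact: cvg_cst.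
    by apply: continuous_comp; [exact: clinear_continuous|exact: ysc].
  have -> : P = fst @^-1` C `&` epi S G `&`
      fst @^-1` [set x | (lcomp (CLinear ysc) F x <= (b x)%:E)%E].
    apply/seteqP; split=> [[x z] /= [Cx Gx [f Fx fc]]|[x z] /= [[Cx Gx]]].
      split=> //; rewrite /lcomp /= Fx /= lee_fin /b.
      by move: fc; rewrite linearB linearD/=; lra.
    rewrite /lcomp/= => fb; split=> //; have := @FNy x; move: fb.
    case Fx : (F x) => [f| |] //=; rewrite lee_fin /b => fb _; exists f => //=.
    by rewrite linearB linearD/=; lra.
  apply: closedI; first apply: closedI => //.
    by apply: closed_comp => // p _; exact: cvg_fst.
  apply: closed_comp; first by move=> p _; exact: cvg_fst.
  exact: closed_sublevel.
have PW x z : P (x, z) -> W z.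
  move=> [/= Cx Gx [f Fx _]]; apply: EW; apply/attainableP; exists x; split=> //.
  by rewrite /dom /= Fx.
have P0 : P (x0, 0) by split=> //=; exists f0 => //; rewrite /c lerDl.
have Pabs z : W z -> exists2 t, 0 < t & exists x, P (x, t *: z).
  move=> [l /= l0 [w /attainableP[x [Cx /(dom_finiteP FNy)[f Fx] Gx]] <-]].
  have [lz|lz] := eqVneq l 0.
    by exists 1 => //; exists x0; rewrite lz scale0r scaler0.
  have lp : 0 < l by rewrite lt_neqAle eq_sym lz.
  (* [x] need not satisfy the bound [c], but a short enough step from [x0]
     towards [x] does, the cost being convex and equal to [c - 1] at [x0]. *)
  pose d := ys (f + y - L x); pose d0 := ys (f0 + y - L x0).
  pose th := (1 + `|d - d0|)^-1.
  have th0 : 0 < th by rewrite invr_gt0 ltr_wpDr.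
  have th1 : th <= 1 by rewrite invf_le1 ?lerDl// ltr_wpDr.
  have thd : th * (d - d0) <= 1.
    rewrite mulrC ler_pdivrMr ?ltr_wpDr// mul1r.
    by have := ler_norm (d - d0); lra.
  exists (th / l); first exact: divr_gt0.
  exists (th *: x + (1 - th) *: x0).
  have epiF x' f' : F x' = f'%:E -> epi K F (x', f') by exact: epi_graph.
  have := epi_convex_comb Fconvex (ltW th0) th1 (epiF _ _ Fx) (epiF _ _ Fx0).
  move=> /epi_finiteP[f' [k [Fx' Kk fk]]]; split=> /=.
  - by move: Cconvex => /convex_setP Cc; apply: Cc => //; exact: ltW.
  - have := epi_convex_comb Gconvex (ltW th0) th1 Gx Gx0; congr (epi S G).
    by congr (_, _); rewrite scaler0 addr0 subr0 scalerA mulfVK.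
  - exists f' => //; have := ysK _ Kk; have := congr1 ys fk.
    move: thd; rewrite /c /d /d0 !linearB !linearD/= !linearZ/= /GRing.scale/=.
    by move=> *; lra.
have [U U0 UP] := closed_convex_relation_open frX frZ Pclosed Pconv Wlin Wclosed PW P0 Pabs.
have [|k kz] := @continuous_linear_extension R Z W zs U c Wlin U0.
  move=> z Uz Wz; have [x [Cx Gx [f Fx fc]]] := UP z Uz Wz.
  by have := H _ _ _ Cx Fx Gx; move: fc => /=; lra.
by exists k => z /EW; exact: kz.
Qed.

End cone_convex_program.

(** * Epigraphs of conjugates and Lagrange multipliers *)

Lemma add_indicator_finite (R : realType) (X Y : tvsType R) (F : X -> \bar Y)
    (D : set X) x f :
  (F \+ indicator D)%E x = f%:E <-> F x = f%:E /\ D x.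
Proof.
rewrite /indicator; split=> [|[-> Dx]]; last first.
  by rewrite mem_set//=; exact: (congr1 EFin (addr0 _)).
case: (boolP (x \in D)) => [/set_mem Dx|_]; last by case: (F x).
by case: (F x) => // f' [<-]; split=> //; exact/esym/(congr1 EFin (addr0 _)).
Qed.

Lemma add_lcomp_finite (R : realType) (X Y Z : tvsType R) (F : X -> \bar Y)
    (G : X -> \bar Z) (T : clinear Z Y) x w :
  (F \+ lcomp T G)%E x = w%:E <->
  exists f g, [/\ F x = f%:E, G x = g%:E & w = f + T g].
Proof.
split=> [|[f [g [Fx Gx ->]]]]; last by rewrite /lcomp /= Fx Gx.
rewrite /lcomp /=; case: (F x) => [f| |] //; case: (G x) => [g| |] //=.
by case=> <-; exists f, g.
Qed.

Lemma add_indicator_neqNy (R : realType) (X Y : tvsType R) (F : X -> \bar Y)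
    (D : set X) x :
  F x <> -oo%E -> (F \+ indicator D)%E x <> -oo%E.
Proof. by rewrite /indicator; case: (x \in D); case: (F x). Qed.

Lemma rank_one_clinear (R : realType) (Z Y : tvsType R) (k : clinear Z R^o) (y : Y) :
  exists T : clinear Z Y, forall z, T z = k z *: y.
Proof.
have [T TE] : exists T : {linear Z -> Y}, forall z, T z = k z *: y.
  by apply: linear_of_fun => l u v; rewrite linearP scalerDl -scalerA.
suff Tc : continuous T by exists (CLinear Tc).
have -> : T = (fun z => k z *: y) :> (Z -> Y) by apply/funext.
move=> z; apply: (cvg_comp2 _ (cvg_cst y) (scale_continuous (_, _))).
exact: clinear_continuous.
Qed.

Theorem theorem3p9 (R : realType) (X Y Z : tvsType R)
    (hX : hausdorff_space X) (hY : hausdorff_space Y) (hZ : hausdorff_space Z)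
    (K : set Y) (Kclosed : closed K) (Kpointed : pointed_cone K)
    (Kconvex : convex_set K) (Kcone : cone K) (Kint : interior K !=set0)
    (S : set Z) (S0 : S !=set0) (Sclosed : closed S)
    (Sconvex : convex_set S) (Scone : cone S)
    (C : set X) (C0 : C !=set0) (Cconvex : convex_set C)
    (F : X -> \bar Y) (Fproper : proper_map F) (Fconvex : cone_convex K F)
    (G : X -> \bar Z) (Gproper : proper_map G) (Gconvex : cone_convex S G) :
  let A : set X := C `&` G @^-1` (EFin @` (-%R @` S)) in
  let E : set Z := EFin @^-1` addset (G @` (C `&` dom F `&` dom G)) S in
  A `&` dom F !=set0 ->
  [\/ exists2 x, (C `&` dom F) x & (EFin @` (-%R @` interior S)) (G x),
      [/\ frechet X /\ frechet Z, closed C,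
          forall y : clinear Y R^o,
            lower_semicontinuous (lcomp y F : X -> \bar R),
          epi_closed S G & sqri E 0]
    | finite_dim (lin E) /\ ri E 0] ->
  epi_conjugate K (F \+ indicator A)%E =
  \bigcup_(T in Lplus S K)
     epi_conjugate K (F \+ indicator C \+ lcomp T G)%E.
Proof.
move=> A E [x0 [Ax0 Fx0]] qual.
have FNy x : F x <> -oo%E by move=> Fx; apply: Fproper.2; exists x.
have GNy x : G x <> -oo%E by move=> Gx; apply: Gproper.2; exists x.
have [f0 Ff0] := (dom_finiteP FNy x0).1 Fx0.
have [Cx0 [_ [s0 Ss0 <-] Gx0]] := Ax0.
have [k0 Kk0] := Kint.
have E0 : E 0.
  apply/(attainableP GNy); exists x0; split=> //; apply/epi_finiteP.
  by exists (- s0), s0; rewrite addNr.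
have Ecore z : E z -> exists2 t, 0 < t & E (- (t *: z)).
  case: qual => [[x [Cx Fx] Gx] _|[_ _ _ _ E0sqri]|[_ E0ri]].
  - exact: slater_core Cx Fx Gx z.
  - exact: sqri_core.
  - exact: ri_core.
have FA_Ny x : (F \+ indicator A)%E x <> -oo%E by exact: add_indicator_neqNy.
have FC_Ny (T : clinear Z Y) x : (F \+ indicator C \+ lcomp T G)%E x <> -oo%E.
  have := @add_indicator_neqNy _ _ _ F C x (FNy x); have := GNy x.
  by rewrite /lcomp /=; case: (F x + _)%E => //; case: (G x).
have FA_dom : dom (F \+ indicator A)%E !=set0.
  by exists x0; apply/(dom_finiteP FA_Ny); exists f0; apply/add_indicator_finite.
have FC_dom (T : clinear Z Y) : dom (F \+ indicator C \+ lcomp T G)%E !=set0.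
  exists x0; apply/(dom_finiteP (FC_Ny T)); exists (f0 + T (- s0)).
  apply/(add_lcomp_finite (F \+ indicator C)%E G T); exists f0, (- s0); split=> //.
  exact/add_indicator_finite.
apply/seteqP; split=> [[L y]|[L y] [T TSK]].
- move=> /(epi_conjugateP Kconvex Kcone Kint FA_Ny _ _ FA_dom) no_better.
  have [|ys [zs [ys1 ysK H]]] := program_multipliers Kconvex Kcone Kint Cconvex FNy
      Fconvex GNy Gconvex (L := L) (y := y) _ E0 Ecore Kk0.
    move=> x f Cx Gx Fx; apply: no_better.
    exact/add_indicator_finite.
  have ysc : continuous ys := positive_linear_continuous Kk0 ysK.
  (* The qualification makes [zs] continuous on [E]. *)
  have [k kz] : exists k : clinear Z R^o, forall z, E z -> k z = zs z.
    case: qual => [[x [Cx Fx] Gx]|[[frX frZ] Cclosed Flsc Gclosed E0sqri]|[Efin _]].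
    + by exists (CLinear (slater_continuous FNy Cx Fx Gx H)).
    + exact: (sqri_continuous Kcone Kint Cconvex FNy Fconvex GNy Gconvex frX frZ
        Cclosed Flsc Gclosed E0sqri ysc ysK H).
    + exact: finite_dim_continuous.
  have kS s : S s -> 0 <= k s.
    move=> Ss; apply: (@ray_slope_ge0 _ (ys (f0 + y - L x0))) => t t0.
    have Es : epi S G (x0, - s0 + (s0 + t *: s)).
      apply/epi_finiteP; exists (- s0), (s0 + t *: s); split=> //.
      by apply: convex_coneD => //; exact: Scone.
    have := H _ _ _ Cx0 Ff0 Es; rewrite -kz ?addKr ?linearZ//.
    by rewrite -[t *: s](addKr s0); apply/(attainableP GNy); exists x0.
  have [T TE] := rank_one_clinear k k0.
  exists T.
    move=> _ [s Ss <-]; rewrite TE; apply: Kcone; first exact: kS.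
    exact: interior_subset.
  apply/(epi_conjugateP Kconvex Kcone Kint (FC_Ny T) _ _ (FC_dom T)).
  move=> x w /(add_lcomp_finite (F \+ indicator C)%E G T).
  move=> [f [g [/add_indicator_finite[Fx Cx] Gx ->]]].
  have ys0 : 0 < ys k0 by rewrite ys1.
  move=> /(positive_linear_interior ysK ys0).
  have Gg : epi S G (x, g).
    apply/epi_finiteP; exists g, 0; rewrite addr0; split=> //.
    exact: cone0.
  have := H _ _ _ Cx Fx Gg; rewrite -kz; last first.
    by apply/(attainableP GNy); exists x; split=> //; apply/(dom_finiteP FNy); exists f.
  by rewrite !(linearB, linearD)/= TE linearZ/= ys1 /GRing.scale/=; lra.
- move=> /(epi_conjugateP Kconvex Kcone Kint (FC_Ny T) _ _ (FC_dom T)) no_better.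
  apply/(epi_conjugateP Kconvex Kcone Kint FA_Ny _ _ FA_dom).
  move=> x f /add_indicator_finite[Fx [Cx [_ [s Ss <-] Gx]]] Kx.
  apply: (no_better x (f + T (- s))).
    apply/(add_lcomp_finite (F \+ indicator C)%E G T); exists f, (- s); split=> //.
    exact/add_indicator_finite.
  have Ts : K (T s) by apply: TSK; exists s.
  have -> : L x - (f + T (- s)) - y = L x - f - y + T s.
    by rewrite [T _]linearN opprB addrA [L x + _ - f]addrAC [LHS]addrAC.
  exact: interior_coneD.
Qed.
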